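(* Let $\mathcal F$ be a finite, degenerate family of graphs satisfying $\mathrm{ex}(n,\mathcal F)=O(n^{1+\alpha})$ for some constant $\alpha\in[0,1)$, and $\tau(\mathcal F)\ge 2$. Let $p>\frac{1}{1-\alpha}$ be a real number. Then there exists $n_0=n_0(\mathcal F,p)$ such that the following holds for all $n\ge n_0$. Let $G$ be an $\mathcal F$-free graph on $n$ vertices with $e_p(G)=\mathrm{ex}_p(n,\mathcal F)$. If there exists an $\mathcal F$-free graph in $\mathcal L(n,\tau(\mathcal F)-1,\ell(\mathcal F)-1)$, then $G\in\mathcal L(n,\tau(\mathcal F)-1,\ell(\mathcal F)-1)$.
   Context: All graphs are finite, simple and undirected; subgraphs need not be induced; graphs are considered up to isomorphism. For a family $\mathcal F$ of graphs, $G$ is $\mathcal F$-free if $G$ contains no $F\in\mathcal F$ as a subgraph. $\mathrm{ex}(n,\mathcal F)$ is the maximum number of edges of an $\mathcal F$-free graph on $n$ vertices. For real $p>0$, $e_p(G)=\sum_{v\in V(G)}d_G(v)^p$, and $\mathrm{ex}_p(n,\mathcal F)$ is the maximum of $e_p(G)$ over all $\mathcal F$-free graphs $G$ on $n$ vertices. A family $\mathcal F$ is degenerate if at least one graph in $\mathcal F$ is bipartite. For a bipartite graph $F$, an independent vertex cover of $F$ is an independent set of vertices that meets every edge of $F$; $\tau(F)$ is the minimum size of an independent vertex cover of $F$; $I(F)$ is the family of all independent vertex covers of $F$ of size $\tau(F)$; and $\ell(F)=\min_{S\in I(F)}\min_{u\in S}d_F(u)$. For a degenerate family, $\tau(\mathcal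 F)=\min\{\tau(F):F\in\mathcal F\text{ is bipartite}\}$ and $\ell(\mathcal F)=\min\{\ell(F):F\in\mathcal F\text{ is bipartite and }\tau(F)=\tau(\mathcal F)\}$. The join $G\vee H$ is obtained from vertex-disjoint copies of $G$ and $H$ by adding all edges between them. A graph $L$ on $t$ vertices is near $\ell$-regular if it is $\ell$-regular when $\ell t$ is even, and otherwise has $t-1$ vertices of degree $\ell$ and one vertex of degree $\ell-1$. $\mathcal L(n,s,\ell)$ is the family of all graphs $K_s\vee L$ where $L$ is a near $\ell$-regular graph on $n-s$ vertices. *)

(* Defs.v *)
From HB Require Import structures.
From mathcomp Require Import all_boot all_order all_algebra.
From mathcomp Require Import reals exp.

Set Implicit Arguments.
Unset Strict Implicit.
Unset Printing Implicit Defensive.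

Import Order.TTheory GRing.Theory Num.Theory.

Local Open Scope nat_scope.

Record sgraph := SGraph {
  vertex :> finType;
  adj : rel vertex;
  adj_sym : symmetric adj;
  adj_irr : irreflexive adj }.

Definition deg (G : sgraph) (v : G) : nat := #|[set w | adj v w]|.

Definition edges (G : sgraph) : {set {set G}} :=
  [set e : {set G} | [exists x, exists y, adj x y && (e == [set x; y])]].

(* [H] is a (not necessarily induced) subgraph of [G], up to isomorphism. *)
Definition subgraph (H G : sgraph) : bool :=
  [exists f : {ffun H -> G},
    injectiveb f && [forall x, forall y, adj x y ==> adj (f x) (f y)]].

Definition isomorphic (G H : sgraph) : Prop :=
  exists2 f : G -> H, bijective f & forall x y, adj (f x) (f y) = adj x y.

Definition family_free (F : seq sgraph) (G : sgraph) : bool :=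
  all (fun H => ~~ subgraph H G) F.

(* The graph on ['I_n] whose edges are the two-element members of [E]: every
   graph on ['I_n] is of this form, so that maxima over all graphs on [n]
   vertices are maxima over the finite type [{set {set 'I_n}}]. *)
Section GraphOfEdges.
Variables (n : nat) (E : {set {set 'I_n}}).

Definition edges_adj : rel 'I_n :=
  fun x y => (x != y) && ([set x; y] \in E).

Lemma edges_adj_sym : symmetric edges_adj.
Proof. by move=> x y; rewrite /edges_adj eq_sym finset.setUC. Qed.

Lemma edges_adj_irr : irreflexive edges_adj.
Proof. by move=> x; rewrite /edges_adj eqxx. Qed.

Definition graph_of_edges : sgraph := SGraph edges_adj_sym edges_adj_irr.
End GraphOfEdges.

Definition ex (n : nat) (F : seq sgraph) : nat :=
  \max_(E : {set {set 'I_n}} | family_free F (graph_of_edges E))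
    #|edges (graph_of_edges E)|.

Definition e_p (R : realType) (p : R) (G : sgraph) : R :=
  (\sum_(v : G) (deg v)%:R `^ p)%R.

(* The default value [0] of the maximum is harmless, as [e_p p G >= 0]. *)
Definition ex_p (R : realType) (p : R) (n : nat) (F : seq sgraph) : R :=
  (\big[Num.max/0]_(E : {set {set 'I_n}} | family_free F (graph_of_edges E))
    e_p p (graph_of_edges E))%R.

Definition bipartite (G : sgraph) : bool :=
  [exists A : {set G},
    [forall x, forall y, adj x y ==> ((x \in A) != (y \in A))]].

Definition degenerate (F : seq sgraph) : bool := has bipartite F.

(* Minimum of a nonempty sequence of naturals; [0] on the empty one. *)
Definition seq_min (s : seq nat) : nat := foldr minn (head 0 s) s.

Definition indep_cover (G : sgraph) (A : {set G}) : bool :=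
  [forall x in A, forall y in A, ~~ adj x y] &&
  [forall x, forall y, adj x y ==> (x \in A) || (y \in A)].

(* A bipartite graph has an independent vertex cover (a side of a
   bipartition), so the minimum is over a nonempty sequence. *)
Definition tau (G : sgraph) : nat :=
  seq_min [seq #|A : {set G}| | A <- enum (@indep_cover G)].

Definition min_covers (G : sgraph) : {set {set G}} :=
  [set A | indep_cover A & #|A| == tau G].

Definition ell (G : sgraph) : nat :=
  seq_min [seq seq_min [seq deg u | u <- enum (A : {set G})]
          | A <- enum (min_covers G)].

Definition family_tau (F : seq sgraph) : nat :=
  seq_min [seq tau H | H <- F & bipartite H].

Definition family_ell (F : seq sgraph) : nat :=
  seq_min [seq ell H | H <- F & bipartite H && (tau H == family_tau F)].

Section Join.
Variables G H : sgraph.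

Definition join_adj : rel (G + H) := fun x y =>
  match x, y with
  | inl a, inl b => adj a b
  | inr a, inr b => adj a b
  | _, _ => true
  end.

Lemma join_adj_sym : symmetric join_adj.
Proof. by move=> [a|a] [b|b] //=; rewrite adj_sym. Qed.

Lemma join_adj_irr : irreflexive join_adj.
Proof. by move=> [a|a] /=; rewrite adj_irr. Qed.

Definition join : sgraph := SGraph join_adj_sym join_adj_irr.
End Join.

Section Complete.
Variable s : nat.

Definition complete_adj : rel 'I_s := fun x y => x != y.

Lemma complete_adj_sym : symmetric complete_adj.
Proof. by move=> x y; rewrite /complete_adj eq_sym. Qed.

Lemma complete_adj_irr : irreflexive complete_adj.
Proof. by move=> x; rewrite /complete_adj eqxx. Qed.

Definition complete : sgraph := SGraph complete_adj_sym complete_adj_irr.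
End Complete.

Definition near_regular (l : nat) (L : sgraph) : Prop :=
  if ~~ odd (l * #|L|) then forall v : L, deg v = l
  else exists v : L, deg v = l - 1 /\ forall w : L, w != v -> deg w = l.

(* Membership of [G] in the family $\mathcal L(n,s,\ell)$; the condition
   [s + #|L| = n] expresses [#|L| = n - s] without truncation. *)
Definition in_calL (n s l : nat) (G : sgraph) : Prop :=
  exists L : sgraph,
    [/\ s + #|L| = n, near_regular l L & isomorphic G (join (complete s) L)].

(* Main.v *)
(* Write s = tau - 1 and q = 1 / (1 - alpha).  Splitting the vertex set into
   blocks of size #|X| gives sum_(v in X) d(v) <= C n #|X|^alpha, so an F-free
   graph has O((n/D)^q) vertices of degree at least D; as p > q, the vertices of
   degree at most eps n contribute only O(eps^(p-q) n^p) to e_p, and boundedly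
   many vertices remain.  Any s + 1 vertices have boundedly many common
   neighbours, so the degrees of these remaining vertices sum to at most
   s n + O(1); since e_p >= s (n-1)^p and x^p < x on ]0, 1[, s of them have
   degree close to n.  If those vertices miss D > 0 edges in total, this
   costs D (n-1)^(p-1), while the vertices outside their common neighbourhood,
   at most D in number, gain only o(D n^(p-1)); so D = 0.  The rest of the graph
   then has maximum degree at most l - 1, and comparing with the given member of
   calL finishes the proof. *)

Require Import Defs.
From HB Require Import structures.
From mathcomp Require Import all_boot all_order all_algebra.
From mathcomp Require Import reals exp.
From mathcomp Require Import zify ring lra.

Set Implicit Arguments.
Unset Strict Implicit.
Unset Printing Implicit Defensive.

Import Order.TTheory GRing.Theory Num.Theory.

Local Open Scope nat_scope.

(** * Neighbourhoods, induced subgraphs and edge counts *)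

Lemma seq_min_mem (s : seq nat) : s != [::] -> seq_min s \in s.
Proof.
case: s => // x s _.
suff foldr_mem y t : foldr minn y t \in y :: t.
  (* [seq_min] folds from the head and then meets the head again; the repeated [x] is absorbed by
     [orbb]. *)
  by have := foldr_mem x (x :: s); rewrite !inE orbA orbb.
elim: t => [|z t IH] /=; first by rewrite inE.
rewrite {1}/minn; case: ifP => _; rewrite !inE ?eqxx ?orbT //.
by move: IH; rewrite inE => /orP[->|->]; rewrite ?orbT.
Qed.

(** Element number i of [enum P] goes to element number i of [enum Q]. The default [y0] only makes
    the map total, so that partial embeddings can be glued by case distinction. *)
Lemma dinj_into (T T' : finType) (y0 : T') (P : {set T}) (Q : {set T'}) :
  #|P| <= #|Q| ->
  exists f : T -> T', {in P &, injective f} /\ {in P, forall x, f x \in Q}.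
Proof.
move=> PQ; exists (fun x => nth y0 (enum Q) (index x (enum P))).
have idx x : x \in P -> index x (enum P) < size (enum Q).
  move=> xP; rewrite -cardE; apply: leq_trans PQ.
  by rewrite cardE index_mem mem_enum.
split=> [x y xP yP /eqP|x xP].
  rewrite nth_uniq ?idx ?enum_uniq // => /eqP xy.
  by rewrite -[x](nth_index x (s := enum P)) ?mem_enum // xy nth_index ?mem_enum.
by rewrite -mem_enum mem_nth // idx.
Qed.

Section Graph.
Variable G : sgraph.
Implicit Types (x y v w : G) (X Y S W : {set G}).

Definition nbrs v : {set G} := [set w | adj v w].

Definition common_nbrs S : {set G} := [set w | [forall x in S, adj x w]].

Lemma in_nbrs v w : (w \in nbrs v) = adj v w.
Proof. by rewrite inE. Qed.

Lemma degE v : deg v = #|nbrs v|.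
Proof. by []. Qed.

Lemma common_nbrsP S w :
  reflect (forall x, x \in S -> adj x w) (w \in common_nbrs S).
Proof. by rewrite inE; apply: forall_inP. Qed.

Lemma common_nbrs_notin S x w : x \in S -> w \in common_nbrs S -> x != w.
Proof.
move=> xS /common_nbrsP/(_ x xS) xw; apply: contraTneq xw => ->.
by rewrite adj_irr.
Qed.

(** A vertex counted on the left is a non-neighbour of some [x] in [S], and [x] has
    [#|G| - 1 - deg x] non-neighbours other than itself; a union bound finishes. *)
Lemma card_common_nbrs_compl S :
  #|~: (S :|: common_nbrs S)| <= \sum_(x in S) (#|G| - 1 - deg x).
Proof.
pose N x := ~: (x |: nbrs x).
have cardN x : #|N x| = #|G| - 1 - deg x.
  by rewrite cardsCs setCK cardsU1 in_nbrs adj_irr subnDA.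
under eq_bigr do rewrite -cardN.
apply: leq_trans (_ : #|\bigcup_(x in S) N x| <= _).
  apply/subset_leq_card/subsetP => w; rewrite !inE negb_or negb_forall.
  case/andP => wS /existsP[x]; rewrite negb_imply => /andP[xS xw].
  apply/bigcupP; exists x => //; rewrite !inE negb_or xw andbT.
  by apply: contraNneq wS => ->.
elim/big_rec2: _ => [|x X n _ le_n]; first by rewrite cards0.
by apply: leq_trans (leq_card_setU _ _) _; rewrite leq_add2l.
Qed.
End Graph.

Lemma exists_subset (T : finType) (k : nat) (Q : {set T}) :
  k <= #|Q| -> exists2 P : {set T}, P \subset Q & #|P| = k.
Proof.
case/card_geqP=> s [uniq_s <- sQ]; exists [set x in s].
  by apply/subsetP => x; rewrite inE; apply: sQ.
by rewrite cardsE; apply/card_uniqP.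
Qed.

(** Embed [H] with [u0] sent to [u], the rest of [A] into [S], the neighbours of [u0] into common
    neighbours of [S] adjacent to [u], and all other vertices into the remaining common neighbours.
    Each edge of [H] has exactly one end in [A], so only edges at [u0] need more than adjacency
    between [S] and its common neighbours. *)
Lemma subgraph_of_cover (H G : sgraph) (A : {set H}) (u0 : H)
    (S : {set G}) (u : G) :
  indep_cover A -> u0 \in A -> #|A| = #|S|.+1 -> u \notin S ->
  deg u0 <= #|nbrs u :&: common_nbrs S| ->
  #|H| <= #|common_nbrs S :\ u| -> subgraph H G.
Proof.
move=> /andP[/forallP indA /forallP covA] u0A cardA uS du0 cardH.
set W := common_nbrs S in du0 cardH.
have [W1 W1sub cardW1] := exists_subset du0.
have adjW1 w : w \in W1 -> adj u w && (w \in W).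
  by move/(subsetP W1sub); rewrite inE in_nbrs.
have sW1 : W1 \subset W :\ u.
  apply/subsetP => w /adjW1/andP[uw wW]; rewrite !inE in wW *.
  by rewrite wW andbT; apply: contraTneq uw => ->; rewrite adj_irr.
have nbrsA x : x \in nbrs u0 -> x \notin A.
  rewrite in_nbrs => u0x; apply/negP => xA.
  have /implyP/(_ u0A)/forallP/(_ x)/implyP/(_ xA) := indA u0.
  by rewrite u0x.
have [f1 [f1I f1S]] : exists f : H -> G, {in A :\ u0 &, injective f} /\
    {in A :\ u0, forall x, f x \in S}.
  by apply: dinj_into => //; move: cardA; rewrite (cardsD1 u0) u0A add1n => -[->].
have [f2 [f2I f2W]] : exists f : H -> G, {in nbrs u0 &, injective f} /\
    {in nbrs u0, forall x, f x \in W1}.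
  by apply: dinj_into => //; rewrite cardW1.
(* The vertices outside [A] and not adjacent to [u0] go to the part of [W] left free by [W1] and
   [u]; the room suffices since [W1] has exactly [deg u0] elements. *)
pose B := ~: (A :|: nbrs u0).
have [f3 [f3I f3W]] : exists f : H -> G, {in B &, injective f} /\
    {in B, forall x, f x \in (W :\ u) :\: W1}.
  apply: dinj_into => //; rewrite cardsDS // cardW1.
  apply: leq_trans (leq_sub2r _ cardH).
  have -> : #|B| = #|H| - #|A :|: nbrs u0| by rewrite cardsCs setCK.
  by apply: leq_sub2l; apply/subset_leq_card/subsetUr.
pose f x := if x == u0 then u else if x \in A then f1 x
            else if x \in nbrs u0 then f2 x else f3 x.
have fP x : [\/ x = u0 /\ f x = u, x \in A :\ u0 /\ f x = f1 x,
                x \in nbrs u0 /\ f x = f2 x | x \in B /\ f x = f3 x].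
  rewrite /f /B !inE; case: eqVneq => [->|xu0]; first by constructor 1.
  case: (boolP (x \in A)) => xA; first by constructor 2; rewrite /= .
  by case: (boolP (adj u0 x)) => xu; [constructor 3|constructor 4].
have fA x : x \in A -> f x = u /\ x = u0 \/ f x \in S.
  move=> xA; case: (fP x) => -[xP ->]; [by left|by right; apply: f1S| |].
    by rewrite (negbTE (nbrsA _ xP)) in xA.
  by rewrite !inE xA in xP.
have fB x : x \notin A -> f x \in W.
  move=> xA; case: (fP x) => -[xP ->].
  - by rewrite xP u0A in xA.
  - by rewrite !inE (negbTE xA) andbF in xP.
  - by have /adjW1/andP[] := f2W _ xP.
  - by have := f3W _ xP; rewrite !inE => /and3P[].
have fN x : adj u0 x -> adj u (f x).
  rewrite -in_nbrs => xN; case: (fP x) => -[xP ->].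
  - by rewrite xP in_nbrs adj_irr in xN.
  - by move: xP; rewrite !inE (negbTE (nbrsA _ xN)) andbF.
  - by have /adjW1/andP[] := f2W _ xP.
  - by rewrite 2!inE xN orbT in xP.
have adjfA x y : x \in A -> adj x y -> adj (f x) (f y).
  move=> xA xy; have yA : y \notin A.
    apply/negP => yA.
    have /implyP/(_ xA)/forallP/(_ y)/implyP/(_ yA) := indA x.
    by rewrite xy.
  case: (fA x xA) => [[-> xu0]|fxS]; first by apply: fN; rewrite -xu0.
  by apply: (common_nbrsP _ _ (fB y yA)).
(* The four target sets, namely [u] alone, [S], [W1] and the rest of [W] without [u], are pairwise
   disjoint; the sixteen cases check this. *)
have fI : injective f.
  have uW1 w : w \in W1 -> w != u.
    by move/(subsetP sW1); rewrite !inE => /andP[].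
  have SW x w : x \in S -> w \in W -> x <> w.
    by move=> xS wW; apply/eqP; apply: common_nbrs_notin xS wW.
  have W1W w : w \in W1 -> w \in W by case/adjW1/andP.
  move=> x y; case: (fP x) => -[xP ->]; case: (fP y) => -[yP ->].
  - by rewrite xP yP.
  - by move=> uf; move: (f1S _ yP); rewrite -uf (negbTE uS).
  - by move=> uf; move: (uW1 _ (f2W _ yP)); rewrite -uf eqxx.
  - by move=> uf; move: (f3W _ yP); rewrite -uf !inE eqxx andbF.
  - by move=> uf; move: (f1S _ xP); rewrite uf (negbTE uS).
  - exact: f1I.
  - by case/SW; [exact: f1S|apply: W1W; exact: f2W].
  - by case/SW; [exact: f1S|move: (f3W _ yP); rewrite 3!inE => /and3P[]].
  - by move=> uf; move: (uW1 _ (f2W _ xP)); rewrite uf eqxx.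
  - by move/esym/SW; case; [exact: f1S|apply: W1W; exact: f2W].
  - exact: f2I.
  - by move=> e; move: (f3W _ yP); rewrite -e !inE (f2W _ xP).
  - by move=> uf; move: (f3W _ xP); rewrite uf !inE eqxx andbF.
  - move/esym/SW; case; [exact: f1S|].
    by move: (f3W _ xP); rewrite 3!inE => /and3P[].
  - by move=> e; move: (f3W _ xP); rewrite e !inE (f2W _ yP).
  - exact: f3I.
apply/existsP; exists [ffun x => f x]; apply/andP; split.
  by apply/injectiveP => x y; rewrite !ffunE => /fI.
apply/forallP => x; apply/forallP => y; apply/implyP => xy; rewrite !ffunE.
have /implyP/(_ xy) := forallP (covA x) y; case/orP => [xA|yA].
  exact: adjfA.
by rewrite adj_sym; apply: adjfA => //; rewrite adj_sym.
Qed.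

Section Induced.
Variables (G : sgraph) (X : {set G}).

Definition induced_adj : rel {x : G | x \in X} := fun x y => adj (val x) (val y).

Lemma induced_adj_sym : symmetric induced_adj.
Proof. by move=> x y; rewrite /induced_adj adj_sym. Qed.

Lemma induced_adj_irr : irreflexive induced_adj.
Proof. by move=> x; rewrite /induced_adj adj_irr. Qed.

Definition induced : sgraph := SGraph induced_adj_sym induced_adj_irr.

Lemma card_induced : #|induced| = #|X|.
Proof. by rewrite /= card_sig; apply: eq_card. Qed.

Lemma deg_induced (v : induced) : deg v = #|nbrs (val v) :&: X|.
Proof.
rewrite degE -(card_imset _ val_inj); apply: eq_card => w.
apply/imsetP/idP => [[x]|]; first by rewrite !inE => xv ->; rewrite (valP x) andbT.
by rewrite !inE => /andP[vw wX]; exists (Sub w wX : induced) => //; rewrite inE.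
Qed.
End Induced.

Lemma subgraph_trans (H1 H2 H3 : sgraph) :
  subgraph H1 H2 -> subgraph H2 H3 -> subgraph H1 H3.
Proof.
move=> /existsP[f /andP[/injectiveP fI /forallP fH]].
move=> /existsP[g /andP[/injectiveP gI /forallP gH]].
apply/existsP; exists [ffun x => g (f x)]; apply/andP; split.
  by apply/injectiveP => x y; rewrite !ffunE => /gI/fI.
apply/forallP => x; apply/forallP => y; apply/implyP => xy; rewrite !ffunE.
apply: (implyP (forallP (gH _) _)); exact: (implyP (forallP (fH _) _)).
Qed.

Lemma family_free_sub (F : seq sgraph) (G1 G2 : sgraph) :
  subgraph G1 G2 -> family_free F G2 -> family_free F G1.
Proof.
move=> sG; apply: sub_all => H; apply: contra => sH.
exact: subgraph_trans sH sG.
Qed.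

Lemma subgraph_induced (G : sgraph) (X : {set G}) : subgraph (induced X) G.
Proof.
apply/existsP; exists [ffun x => val x]; apply/andP; split.
  by apply/injectiveP => x y; rewrite !ffunE => /val_inj.
by apply/forallP => x; apply/forallP => y; apply/implyP; rewrite !ffunE.
Qed.

Lemma isomorphic_sym (G1 G2 : sgraph) : isomorphic G1 G2 -> isomorphic G2 G1.
Proof.
by case=> f [g fK gK] fadj; exists g => [|x y]; [exists f|rewrite -fadj !gK].
Qed.

Lemma isomorphic_subgraph (G1 G2 : sgraph) : isomorphic G1 G2 -> subgraph G1 G2.
Proof.
case=> f /bij_inj fI fadj.
apply/existsP; exists [ffun x => f x]; apply/andP; split.
  by apply/injectiveP => x y; rewrite !ffunE => /fI.
by apply/forallP => x; apply/forallP => y; apply/implyP; rewrite !ffunE fadj.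
Qed.

Lemma isomorphic_deg (G1 G2 : sgraph) (f : G1 -> G2) :
  bijective f -> (forall x y, adj (f x) (f y) = adj x y) ->
  forall v, deg (f v) = deg v.
Proof.
move=> fbij fadj v; rewrite !degE -(card_imset _ (bij_inj fbij)).
apply: eq_card => w; case: fbij => g fK gK.
by rewrite -[w]gK mem_imset ?in_nbrs; [rewrite fadj|exact: bij_inj (Bijective fK gK)].
Qed.

(** Makes the maxima defining [ex] and [ex_p], taken over edge sets on ['I_n], apply to every graph
    with [n] vertices. *)
Lemma graph_of_edges_surj (n : nat) (G : sgraph) :
  #|G| = n -> exists E : {set {set 'I_n}}, isomorphic G (graph_of_edges E).
Proof.
move=> cardG; pose f (x : G) := cast_ord cardG (enum_rank x).
have fbij : bijective f.
  exists (fun i => enum_val (cast_ord (esym cardG) i)) => x; rewrite /f.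
    by rewrite cast_ordK enum_rankK.
  by rewrite enum_valK cast_ordKV.
have fI := bij_inj fbij.
exists [set f @: e | e : {set G} in edges G]; exists f => // x y.
apply/andP/idP => [[_ /imsetP[e eG]]|xy].
  have -> : [set f x; f y] = f @: [set x; y] by rewrite imsetU1 imset_set1.
  move/(imset_inj fI) => xye; move: eG; rewrite -xye inE.
  case/existsP=> a /existsP[b /andP[ab /eqP abE]].
  have xa : x \in [set a; b] by rewrite -abE !inE eqxx.
  have ya : y \in [set a; b] by rewrite -abE !inE eqxx orbT.
  have ba : b \in [set x; y] by rewrite abE !inE eqxx orbT.
  have aa : a \in [set x; y] by rewrite abE !inE eqxx.
  move: xa ya ba aa; rewrite !inE => /orP[]/eqP-> /orP[]/eqP-> //.
  - by rewrite orbb => /eqP ba; rewrite ba adj_irr in ab.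
  - by rewrite adj_sym.
  - by move=> _; rewrite orbb => /eqP ba; rewrite ba adj_irr in ab.
split; first by apply: contraTneq xy => /fI->; rewrite adj_irr.
apply/imsetP; exists [set x; y]; last by rewrite imsetU1 imset_set1.
by rewrite inE; apply/existsP; exists x; apply/existsP; exists y; rewrite xy eqxx.
Qed.

(** * Degree sums, double counting and extremal numbers *)

(** Every arc lies in the square [setX e e] of its edge, which has four elements. The factor 4
    instead of 2 is harmless, as only the order of magnitude matters. *)
Lemma sum_deg_le_edges (G : sgraph) : \sum_(v : G) deg v <= 4 * #|edges G|.
Proof.
pose arcs : {set G * G} := [set a | adj a.1 a.2].
have -> : \sum_(v : G) deg v = #|arcs|.
  rewrite -sum1_card (eq_bigl (fun a => adj a.1 a.2)); last by move=> a; rewrite inE.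
  rewrite -(pair_big_dep predT (fun v w => adj v w) (fun _ _ => 1)) /=.
  by apply: eq_bigr => v _; rewrite sum1dep_card.
have sarcs : arcs \subset \bigcup_(e in edges G) setX e e.
  apply/subsetP => -[a b]; rewrite inE /= => ab; apply/bigcupP.
  exists [set a; b]; last by rewrite !inE !eqxx orbT.
  by rewrite inE; apply/existsP; exists a; apply/existsP; exists b; rewrite ab eqxx.
apply: leq_trans (subset_leq_card sarcs) _.
rewrite mulnC -sum_nat_const.
elim/big_rec2: _ => [|e n X eG le_n]; first by rewrite cards0.
apply: leq_trans (leq_card_setU _ _) (leq_add _ le_n).
move: eG; rewrite inE => /existsP[a /existsP[b /andP[_ /eqP->]]].
by rewrite cardsX cards2; case: (a != b).
Qed.

Lemma sum_deg_le_ex (F : seq sgraph) (G : sgraph) :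
  family_free F G -> \sum_(v : G) deg v <= 4 * ex #|G| F.
Proof.
move=> freeG; have [E isoE] := graph_of_edges_surj (erefl #|G|).
have freeE : family_free F (graph_of_edges E).
  by apply: family_free_sub freeG; apply/isomorphic_subgraph/isomorphic_sym.
apply: leq_trans (_ : 4 * #|edges (graph_of_edges E)| <= _); last first.
  rewrite leq_mul2l /=.
  by apply: (leq_bigmax_cond (F := fun E => #|edges (graph_of_edges E)|)).
apply: leq_trans (sum_deg_le_edges _); case: isoE => f fbij fadj.
rewrite (reindex f) /=; last exact: onW_bij.
by rewrite leq_eqVlt; apply/orP; left; apply/eqP/eq_bigr => v _; rewrite isomorphic_deg.
Qed.

(** Order the vertices by [enum_rank] and split each degree into neighbours above and below.
    Exchanging summations shows that the two total counts agree. *)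
Lemma odd_sum_deg (G : sgraph) : ~~ odd (\sum_(v : G) deg v).
Proof.
pose lt := fun v w : G => enum_rank v < enum_rank w.
have deg_split v : deg v =
    \sum_(w | lt v w) adj v w + \sum_(w | lt w v) adj v w.
  rewrite degE -sum1_card (eq_bigl (adj v)); last by move=> w; rewrite inE.
  rewrite (bigID (lt v)) /=; congr (_ + _).
    rewrite big_mkcond [RHS]big_mkcond; apply: eq_bigr => w _.
    by case: (adj v w); case: (lt v w).
  rewrite big_mkcond [RHS]big_mkcond; apply: eq_bigr => w _; rewrite /lt -leqNgt leq_eqVlt.
  case: (boolP (adj v w)) => vw; last by case: ifP.
  case: eqP => // wv; move: vw.
  by rewrite -[w]enum_rankK (ord_inj wv) enum_rankK adj_irr.
under eq_bigr do rewrite deg_split.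
rewrite big_split /= [X in _ + X](exchange_big_dep predT) //=.
have -> : \sum_j \sum_(i | lt j i) adj i j = \sum_v \sum_(w | lt v w) adj v w.
  by apply: eq_bigr => v _; apply: eq_bigr => w _; rewrite adj_sym.
by rewrite addnn odd_double.
Qed.

(** Both sides count the adjacent pairs in the product of [X] and [Y]. *)
Lemma sum_nbrsI (G : sgraph) (X Y : {set G}) :
  \sum_(v in X) #|nbrs v :&: Y| = \sum_(w in Y) #|nbrs w :&: X|.
Proof.
have cardI Z v : #|nbrs v :&: Z| = \sum_(w in Z) adj v w.
  rewrite -sum1_card big_mkcond [RHS]big_mkcond; apply: eq_bigr => w _.
  by rewrite !inE; case: (adj v w); case: (w \in Z).
under eq_bigr do rewrite cardI.
rewrite exchange_big; apply: eq_bigr => w _; rewrite cardI.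
by apply: eq_bigr => v _; rewrite adj_sym.
Qed.

(* Splitting [V(G)] into blocks of size [m], the arcs leaving [X] are counted
   in the graphs spanned by [X] and one block. *)
Lemma sum_deg_blocks (G : sgraph) (X : {set G}) (m K : nat) :
  0 < m ->
  (forall Y : {set G}, #|Y| <= m -> \sum_(v in X) #|nbrs v :&: Y| <= K) ->
  \sum_(v in X) deg v <= (#|G| %/ m).+1 * K.
Proof.
move=> m0 leK.
suff block k (Y : {set G}) : #|Y| = k ->
    \sum_(v in X) #|nbrs v :&: Y| <= (k %/ m).+1 * K.
  have := block _ [set: G] (cardsT _); under eq_bigr do rewrite setIT.
  by under [X in X <= _ -> _]eq_bigr do rewrite -degE.
elim/ltn_ind: k Y => k IH Y cardY.
have [lt_k|le_m] := ltnP k m.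
  by rewrite divn_small // mul1n; apply: leK; rewrite cardY ltnW.
have [B sB cardB] : exists2 B : {set G}, B \subset Y & #|B| = m.
  by apply: exists_subset; rewrite cardY.
have cardYB : #|Y :\: B| = k - m by rewrite cardsDS // cardY cardB.
have lt_km : k - m < k by rewrite ltn_subrL m0 (leq_trans m0 le_m).
have := IH _ lt_km _ cardYB; rewrite divnBr ?dvdnn // divnn m0.
have km0 : 0 < k %/ m by rewrite divn_gt0.
rewrite subn1 prednK // mulSn => leYB.
apply: leq_trans (leq_add (leK B _) leYB); last by rewrite cardB.
rewrite -big_split /=; apply: leq_sum => v _.
apply: leq_trans (leq_card_setU _ _); apply/subset_leq_card/subsetP => w.
by rewrite !inE; case: (w \in B); case: (adj v w); rewrite ?orbT ?orbF.
Qed.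

(** The arcs from [X] to [Y] are arcs of the graph induced on [X :|: Y], which is again free of the
    family. *)
Lemma sum_nbrsI_le_ex (F : seq sgraph) (G : sgraph) (X Y : {set G}) :
  family_free F G ->
  \sum_(v in X) #|nbrs v :&: Y| <= 4 * ex #|X :|: Y| F.
Proof.
move=> freeG.
have freeI : family_free F (induced (X :|: Y)).
  exact: family_free_sub (subgraph_induced _) freeG.
apply: leq_trans (_ : _ <= \sum_(v in X :|: Y) #|nbrs v :&: (X :|: Y)|) _.
  rewrite [X in X <= _]big_mkcond [X in _ <= X]big_mkcond /=; apply: leq_sum => v _.
  rewrite !inE; case: (v \in X) => //=.
  by apply/subset_leq_card/setIS/subsetUr.
have := sum_deg_le_ex freeI; rewrite card_induced; apply: leq_trans.
rewrite leq_eqVlt; apply/orP; left; apply/eqP.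
by rewrite big_sub; apply: eq_bigr => v _; rewrite deg_induced.
Qed.

(** * Degree sums from the bound on the number of edges *)

Local Open Scope ring_scope.

Lemma le_powR (R : realType) (x y r : R) :
  0 <= r -> 0 <= x -> x <= y -> x `^ r <= y `^ r.
Proof.
move=> r0 x0 xy; apply: ge0_ler_powR => //; rewrite nnegrE //.
exact: le_trans xy.
Qed.

Lemma lt_powR (R : realType) (x y r : R) :
  0 < r -> 0 <= x -> x < y -> x `^ r < y `^ r.
Proof.
move=> r0 x0 xy; apply: gt0_ltr_powR => //; rewrite nnegrE //.
by apply/ltW/(le_lt_trans x0).
Qed.

Lemma exists_small_powR (R : realType) (c r : R) :
  0 < c -> 0 < r -> exists x : R, [/\ 0 < x, x < 1 & x `^ r <= c].
Proof.
move=> c0 r0; have cr : 0 < c `^ r^-1 by exact: powR_gt0.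
(* The term 1/2 is there only to keep the witness below 1. *)
exists (Num.min 2^-1 (c `^ r^-1)); split.
- by rewrite lt_min cr andbT invr_gt0.
- by rewrite gt_min; apply/orP; left; lra.
have {2}-> : c = (c `^ r^-1) `^ r.
  by rewrite -powRrM mulVf ?gt_eqF // powRr1 // ltW.
apply: le_powR; first exact: ltW.
  by rewrite le_min powR_ge0 invr_ge0 ler0n.
by rewrite ge_min lexx orbT.
Qed.

Section DegreeBounds.
Variables (R : realType) (F : seq sgraph) (alpha p C : R).
Hypothesis alpha_ge0 : 0 <= alpha.
Hypothesis alpha_lt1 : alpha < 1.
Hypothesis p_gt : (1 - alpha)^-1 < p.
Hypothesis C_ge0 : 0 <= C.
Hypothesis exC : forall k : nat, (ex k F)%:R <= C * k%:R `^ (1 + alpha).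

Let q := (1 - alpha)^-1.
(** The 8 is 4 from [sum_nbrsI_le_ex] times 2 from the number of blocks; the power of 2 arises
    because [X] together with a block has up to 2 [#|X|] vertices. *)
Let C1 := 8 * C * 2 `^ (1 + alpha).

Lemma deg_const_ge0 : 0 <= C1.
Proof. by rewrite /C1 !mulr_ge0 ?powR_ge0. Qed.

Lemma q_ge1 : 1 <= q.
Proof. by rewrite /q invf_ge1 ?subr_gt0 // gerBl. Qed.

Lemma sum_deg_le_powR (G : sgraph) (X : {set G}) : family_free F G ->
  (\sum_(v in X) deg v)%:R <= C1 * #|G|%:R * #|X|%:R `^ alpha.
Proof.
move=> freeG; set m := #|X|.
have [m0|m_gt0] := posnP m.
  by rewrite (cards0_eq m0) big_set0 mulr_ge0 ?mulr_ge0 ?deg_const_ge0 ?powR_ge0.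
have mR0 : 0 < m%:R :> R by rewrite ltr0n.
(* A maximum over all orders up to 2m takes the place of monotonicity of [ex] in the number of
   vertices. *)
pose K := \max_(k < (2 * m).+1) (4 * ex k F)%N.
have [k0 K_eq] : {k0 : 'I_(2 * m).+1 | K = (4 * ex k0 F)%N}.
  by apply: bigop.eq_bigmax; rewrite card_ord.
have leK (Y : {set G}) : (#|Y| <= m)%N ->
    (\sum_(v in X) #|nbrs v :&: Y| <= K)%N.
  move=> Ym; apply: leq_trans (sum_nbrsI_le_ex _ _ freeG) _.
  have XY : (#|X :|: Y| < (2 * m).+1)%N.
    by rewrite ltnS mul2n -addnn (leq_trans (leq_card_setU _ _)) // leq_add2l.
  exact: (leq_bigmax (F := fun k : 'I_(2 * m).+1 => (4 * ex k F)%N) (Ordinal XY)).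
have := sum_deg_blocks m_gt0 leK; rewrite -(ler_nat R) natrM => le_sum.
have KR : K%:R <= 4 * C * (2 `^ (1 + alpha) * (m%:R * m%:R `^ alpha)) :> R.
  rewrite K_eq natrM -mulrA ler_wpM2l //.
  apply: le_trans (exC _) _; rewrite ler_wpM2l //.
  have -> : m%:R * m%:R `^ alpha = m%:R `^ (1 + alpha) :> R.
    by rewrite powRD ?(gt_eqF mR0) ?implybT // powRr1 // ltW.
  rewrite -powRM //; apply: le_powR => //; first exact: addr_ge0.
  by rewrite -natrM ler_nat -ltnS.
(* Since m is at most [#|G|], the extra block at most doubles the count. *)
have blocks : (#|G| %/ m).+1%:R * m%:R <= 2 * #|G|%:R :> R.
  rewrite -!natrM ler_nat mulSn mul2n -addnn leq_add ?max_card //.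
  by rewrite leq_trunc_div.
rewrite -(ler_pM2r mR0); apply: le_trans (ler_wpM2r (ltW mR0) le_sum) _.
rewrite mulrAC; apply: le_trans (ler_wpM2r _ blocks) _ => //.
apply: le_trans (ler_wpM2l _ KR) _; first by rewrite mulr_ge0.
by rewrite le_eqVlt; apply/orP; left; apply/eqP; rewrite /C1; ring.
Qed.

(** With N such vertices, [sum_deg_le_powR] gives N D <= C1 n N^alpha, that is N^(1-alpha) <= C1 n /
    D; raise this to the power q. *)
Lemma card_deg_ge (G : sgraph) (D : R) : family_free F G -> 0 < D ->
  #|[set v : G | D <= (deg v)%:R]|%:R <= (C1 * #|G|%:R / D) `^ q.
Proof.
move=> freeG D0; set X := [set _ | _]; set N := #|X|%:R.
have a1 : 1 - alpha != 0 by rewrite gt_eqF // subr_gt0.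
have [N0|N_gt0] := leP N 0; first by apply: le_trans N0 (powR_ge0 _ _).
have ND : N * D <= C1 * #|G|%:R * N `^ alpha.
  apply: le_trans (sum_deg_le_powR X freeG).
  rewrite natr_sum /N -sum1_card natr_sum mulr_suml; apply: ler_sum => v.
  by rewrite inE mul1r.
have -> : N = (N `^ (1 - alpha)) `^ q by rewrite -powRrM mulfV // powRr1 // ltW.
apply: le_powR; rewrite ?powR_ge0 //; first by apply: le_trans q_ge1.
rewrite powRB ?(gt_eqF N_gt0) ?implybT // powRr1 ?(ltW N_gt0) //.
by rewrite ler_pdivrMr ?powR_gt0 // mulrAC ler_pdivlMr.
Qed.

(** Sum of the geometric series with first term (2 C1)^q and ratio 2^-(p-q). *)
Let A := (2 * C1) `^ q / (1 - 2^-1 `^ (p - q)).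

Lemma half_powR_lt1 : 2^-1 `^ (p - q) < 1 :> R.
Proof.
have := @lt_powR R 2^-1 1 (p - q); rewrite powR1; apply.
- by rewrite subr_gt0.
- by rewrite invr_ge0 ler0n.
- by rewrite invf_lt1 ?ltr1n.
Qed.

Lemma small_deg_const_ge0 : 0 <= A.
Proof. by rewrite /A divr_ge0 ?powR_ge0 // subr_ge0 ltW // half_powR_lt1. Qed.

(* Halving the threshold: the vertices of degree in (theta/2, theta] contribute
   at most a constant times n^q theta^(p-q), so the contributions form a
   geometric series of ratio 2^-(p-q) < 1. *)
Lemma sum_small_deg (G : sgraph) (theta : R) : family_free F G -> 0 < theta ->
  \sum_(v : G | (deg v)%:R <= theta) (deg v)%:R `^ p
    <= A * #|G|%:R `^ q * theta `^ (p - q).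
Proof.
move=> freeG theta0.
have q0 : 0 < q by apply: lt_le_trans q_ge1.
have p0 : 0 < p by apply: lt_trans p_gt.
(* Induction on a power of 2 above [theta]: halving [theta] lowers the exponent, and for [theta] < 1
   only isolated vertices remain, contributing 0^p = 0. *)
have [k lek] : exists k, theta < 2 ^+ k.
  exists (Num.bound theta); apply: lt_trans (archi_boundP (ltW theta0)) _.
  by rewrite -natrX ltr_nat ltn_expl.
elim: k theta theta0 lek => [|k IH] theta theta0 lek.
  rewrite big1 => [|v le_v].
    apply: mulr_ge0; last exact: powR_ge0.
    by apply: mulr_ge0; [exact: small_deg_const_ge0|exact: powR_ge0].
  have : (deg v)%:R < 1 :> R by apply: le_lt_trans lek.
  by rewrite -[1]/(1%:R) ltr_nat ltnS leqn0 => /eqP->; rewrite powR0 // gt_eqF.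
have half0 : 0 < theta / 2 by rewrite divr_gt0.
have le_half : theta / 2 <= theta by lra.
have := IH _ half0; rewrite ltr_pdivrMr // -exprSr => /(_ lek) le_small.
rewrite (bigID (fun v => (deg v)%:R <= theta / 2)) /=.
rewrite (eq_bigl (fun v : G => (deg v)%:R <= theta / 2)); last first.
  move=> v; rewrite andbC; case: (boolP (_ <= theta / 2)) => // le_v.
  by rewrite (le_trans le_v).
have n0 : 0 <= #|G|%:R :> R by [].
have le_large : \sum_(v : G | ((deg v)%:R <= theta) && ~~ ((deg v)%:R <= theta / 2))
    (deg v)%:R `^ p <= (2 * C1) `^ q * #|G|%:R `^ q * theta `^ (p - q).
  have := card_deg_ge freeG half0; set X := [set _ | _] => le_X.
  apply: le_trans (_ : _ <= \sum_(v in X) theta `^ p) _.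
    rewrite [X in X <= _]big_mkcond [X in _ <= X]big_mkcond; apply: ler_sum => v _.
    case: ifP => [/andP[le_v]|_]; last by case: ifP; rewrite ?powR_ge0.
    by rewrite -ltNge inE => /ltW->; apply: le_powR => //; exact: ltW.
  rewrite sumr_const -[_ *+ #|_|]mulr_natl.
  apply: le_trans (ler_wpM2r (powR_ge0 _ _) le_X) _.
  have -> : C1 * #|G|%:R / (theta / 2) = 2 * C1 * #|G|%:R * theta^-1 by field; lra.
  have C10 : 0 <= 2 * C1 by apply: mulr_ge0 => //; exact: deg_const_ge0.
  have thV0 : 0 <= theta^-1 by rewrite invr_ge0 ltW.
  rewrite (powRM q (mulr_ge0 C10 n0) thV0) (powRM q C10 n0).
  have -> : theta^-1 `^ q = (theta `^ q)^-1.
    by rewrite -[theta^-1]powR_inv1 ?(ltW theta0) // -powRrM mulN1r powRN.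
  rewrite powRB ?(gt_eqF theta0) ?implybT //.
  by rewrite -!mulrA [(_ `^ q)^-1 * _]mulrC.
apply: le_trans (lerD le_small le_large) _.
have AE : A * 2^-1 `^ (p - q) + (2 * C1) `^ q = A.
  by rewrite /A; field; rewrite gt_eqF // subr_gt0 half_powR_lt1.
have half_ge0 : 0 <= 2^-1 :> R by rewrite invr_ge0 ler0n.
rewrite [theta / 2]mulrC (powRM _ half_ge0 (ltW theta0)).
have factor (a r b x y : R) : a * x * (r * y) + b * x * y = (a * r + b) * x * y by ring.
by rewrite factor AE.
Qed.
End DegreeBounds.

(** * Graphs with s dominating vertices *)

Local Open Scope nat_scope.

(** That [x] occurs in [s] is expressed through predicates holding on all of [s], because [T], later
    [sgraph], carries no decidable equality. *)
Lemma seq_min_map_witness (T : Type) (f : T -> nat) (P : pred T) (s : seq T) :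
  has P s ->
  exists x, [/\ P x, f x = seq_min [seq f x | x <- s & P x]
              & forall Q : pred T, all Q s -> Q x].
Proof.
move=> hasP; set m := seq_min _.
have : m \in [seq f x | x <- s & P x].
  by apply: seq_min_mem; rewrite -size_eq0 size_map size_filter -lt0n -has_count.
elim: s {hasP} m => //= x s IH m; case: (boolP (P x)) => Px /=; last first.
  by case/IH => y [Py fy Qy]; exists y; split=> // Q /andP[_ /Qy].
rewrite inE => /orP[/eqP->|/IH[y [Py fy Qy]]].
  by exists x; split=> // Q /andP[].
by exists y; split=> // Q /andP[_ /Qy].
Qed.

(** The local obstruction extracted from the family, with [s] one less than its tau and [l] its ell;
    [h] says how many common neighbours are needed before it takes effect. *)
Definition sparse_outside (F : seq sgraph) (s l h : nat) : Prop :=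
  forall G : sgraph, family_free F G ->
  forall (S : {set G}) (u : G), #|S| = s -> u \notin S ->
  h <= #|common_nbrs S :\ u| -> #|nbrs u :&: common_nbrs S| < l.

Lemma ell_witness (H : sgraph) : 0 < tau H ->
  exists A : {set H}, exists u,
    [/\ indep_cover A, #|A| = tau H, u \in A & deg u = ell H].
Proof.
move=> tau0; have : tau H \in [seq #|A : {set H}| | A <- enum (@indep_cover H)].
  (* [seq_min] of the empty list is 0, so positivity of [tau H] guarantees that a cover exists. *)
  by apply: seq_min_mem; apply: contraTneq tau0; rewrite /tau => ->.
case/mapP=> A0; rewrite mem_enum => A0cov tauA0.
have A0min : A0 \in min_covers H by rewrite inE tauA0 eqxx andbT.
have : ell H \in [seq seq_min [seq deg u | u <- enum (A : {set H})]
                 | A <- enum (min_covers H)].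
  apply: seq_min_mem; rewrite -size_eq0 size_map -cardE -lt0n.
  by apply/card_gt0P; exists A0.
case/mapP=> A; rewrite mem_enum inE => /andP[Acov /eqP cardA] ellA.
have : ell H \in [seq deg u | u <- enum A].
  rewrite ellA; apply: seq_min_mem.
  by rewrite -size_eq0 size_map -cardE cardA -lt0n.
by case/mapP=> u; rewrite mem_enum => uA ->; exists A, u.
Qed.

(** Take a bipartite [H] attaining both tau and ell of the family, and [h] its order. A violation
    would let [subgraph_of_cover] embed [H] in [G]. *)
Lemma sparse_outside_family (F : seq sgraph) :
  degenerate F -> 2 <= family_tau F ->
  exists2 h, family_ell F <= h &
    sparse_outside F (family_tau F - 1) (family_ell F) h.
Proof.
move=> hasF tau2; have tau0 : 0 < family_tau F by apply: leq_trans tau2.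
have [H1 [bipH1 tauH1 QH1]] := seq_min_map_witness tau hasF.
have [|H [/andP[bipH /eqP tauH] ellH QH]] :=
    @seq_min_map_witness _ ell (fun H => bipartite H && (tau H == family_tau F)) F.
  (* [H1] attains [family_tau], so the minimum defining [family_ell] is over a nonempty list. *)
  rewrite -[has _ F]negbK -all_predC; apply/negP => /QH1.
  by rewrite /= bipH1 tauH1 eqxx.
have [|A [u0 [Acov cardA u0A degu0]]] := @ell_witness H; first by rewrite tauH.
have -> : family_ell F = deg u0 by rewrite degu0 ellH.
exists #|H|; first exact: max_card.
move=> G freeG S u cardS uS leS; rewrite ltnNge; apply/negP => le_deg.
have := QH _ freeG; apply/negP; rewrite negbK.
apply: (subgraph_of_cover Acov u0A _ uS) => //.
by rewrite cardA tauH cardS subn1 prednK.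
Qed.

Section SparseOutside.
Variables (F : seq sgraph) (s l h : nat).
Hypothesis sparse : sparse_outside F s l h.
Hypothesis le_lh : l <= h.

(** Split [Y] into one vertex [u] and [s] others: every common neighbour of [Y] is a neighbour of
    [u] among the common neighbours of the others. If there were [h] of them, [u] would have at
    least [l] such neighbours. *)
Lemma card_common_nbrs_lt (G : sgraph) (Y : {set G}) :
  family_free F G -> #|Y| = s.+1 -> #|common_nbrs Y| < h.
Proof.
move=> freeG cardY; rewrite ltnNge; apply/negP => le_h.
have /card_gt0P[u uY] : 0 < #|Y| by rewrite cardY.
have cardS : #|Y :\ u| = s by move: cardY; rewrite (cardsD1 u) uY add1n => -[].
have uS : u \notin Y :\ u by rewrite !inE eqxx.
have sub w : w \in common_nbrs Y -> (w \in nbrs u) && (w \in common_nbrs (Y :\ u)).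
  move/common_nbrsP => adjY; rewrite in_nbrs adjY //=.
  by apply/common_nbrsP => x; rewrite inE => /andP[_ /adjY].
have le_S : h <= #|common_nbrs (Y :\ u) :\ u|.
  apply: leq_trans le_h _; apply/subset_leq_card/subsetP => w wY.
  have /andP[uw wS] := sub _ wY; rewrite !in_setD1 wS andbT.
  by apply: contraTneq uw => ->; rewrite in_nbrs adj_irr.
have := sparse freeG cardS uS le_S; rewrite ltnNge => /negP; apply.
apply: leq_trans le_lh _; apply: leq_trans le_h _.
by apply/subset_leq_card/subsetP => w /sub; rewrite in_setI.
Qed.

(** Count arcs into [X] from the other end. A vertex with at most [s] neighbours in [X] contributes
    at most [s]. Any other is a common neighbour of some [s.+1] elements of [X]; there are at most
    [2 ^ #|X|] such subsets, each with fewer than [h] common neighbours. *)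
Lemma sum_deg_le_sparse (G : sgraph) (X : {set G}) : family_free F G ->
  \sum_(v in X) deg v <= s * #|G| + #|X| * (2 ^ #|X| * h).
Proof.
move=> freeG; pose B : {set G} := [set w | s < #|nbrs w :&: X|].
have -> : \sum_(v in X) deg v = \sum_(w : G) #|nbrs w :&: X|.
  under eq_bigr => v _ do rewrite degE -[nbrs v]setIT.
  by rewrite sum_nbrsI; apply: eq_bigl => w; rewrite inE.
apply: leq_trans (_ : _ <= \sum_(w : G) (s + (w \in B) * #|X|)) _.
  apply: leq_sum => w _; rewrite [w \in B]inE.
  case: (ltnP s) => [_|le_s]; last by rewrite mul0n addn0.
  by rewrite mul1n (leq_trans _ (leq_addl _ _)) // subset_leq_card // subsetIr.
rewrite big_split /= sum_nat_const mulnC leq_add2l -big_distrl /= mulnC leq_mul2l.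
apply/orP; right.
have -> : \sum_(w : G) (w \in B : nat) = #|B|.
  by rewrite -sum1_card [RHS]big_mkcond; apply: eq_bigr => w _; case: (w \in B).
have sB : B \subset \bigcup_(Y in powerset X | #|Y| == s.+1) common_nbrs Y.
  apply/subsetP => w; rewrite inE => /exists_subset[Y sY cardY].
  apply/bigcupP; exists Y.
    by rewrite powersetE cardY eqxx andbT (subset_trans sY) ?subsetIr.
  by apply/common_nbrsP => x /(subsetP sY); rewrite inE in_nbrs adj_sym => /andP[].
apply: leq_trans (subset_leq_card sB) _.
rewrite -card_powerset -sum_nat_const big_mkcondr /=.
elim/big_rec2: _ => [|Y n Z _ le_n]; first by rewrite cards0.
apply: leq_trans (leq_card_setU _ _) (leq_add _ le_n).
case: ifP => [/eqP cardY|_]; last by rewrite cards0.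
exact/ltnW/card_common_nbrs_lt.
Qed.
End SparseOutside.

(** * Stability *)

Local Open Scope ring_scope.

(** The only consequence of the edge bound used from here on; [eps] and [K] depend on [eta] but not
    on [G]. *)
Definition few_large_degrees (R : realType) (F : seq sgraph) (p : R) : Prop :=
  forall eta : R, 0 < eta -> exists eps : R, exists K : nat,
  forall G : sgraph, family_free F G ->
    \sum_(v : G | ~~ (eps * #|G|%:R <= (deg v)%:R)) (deg v)%:R `^ p
      <= eta * #|G|%:R `^ p /\
    (#|[set v : G | (eps * #|G|%:R <= (deg v)%:R)%R]| <= K)%N.

Lemma few_large_degrees_ex (R : realType) (F : seq sgraph) (alpha p C : R) :
  0 <= alpha -> alpha < 1 -> (1 - alpha)^-1 < p -> 0 <= C ->
  (forall k : nat, (ex k F)%:R <= C * k%:R `^ (1 + alpha)) ->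
  few_large_degrees F p.
Proof.
move=> alpha0 alpha1 p_gt C0 exC eta eta0.
set q := (1 - alpha)^-1 in p_gt.
pose C1 := 8 * C * 2 `^ (1 + alpha).
pose A := (2 * C1) `^ q / (1 - 2^-1 `^ (p - q)).
have A0 : 0 <= A by exact: small_deg_const_ge0.
have A1 : 0 < A + 1 by rewrite ltr_wpDl.
have pq0 : 0 < p - q by rewrite subr_gt0.
(* This makes A eps^(p-q) at most [eta]; dividing by [A + 1] avoids the case A = 0. With threshold
   [eps * #|G|%:R], the count in [card_deg_ge] no longer depends on n, whence [K]. *)
have [eps [eps0 _ le_eps]] := exists_small_powR (divr_gt0 eta0 A1) pq0.
pose K := Num.bound ((C1 / eps) `^ q).
have ltK : (C1 / eps) `^ q < K%:R by apply: archi_boundP; exact: powR_ge0.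
exists eps, K => G freeG; have [n0|n_gt0] := posnP #|G|.
  split; last by apply: leq_trans (max_card _) _; rewrite n0.
  rewrite big1 ?mulr_ge0 ?powR_ge0 ?(ltW eta0) // => v _.
  by have := fintype0 v n0.
have nR0 : 0 < #|G|%:R :> R by rewrite ltr0n.
have en0 : 0 < eps * #|G|%:R by rewrite mulr_gt0.
split.
  apply: le_trans (_ : _ <= \sum_(v : G | (deg v)%:R <= eps * #|G|%:R)
                             (deg v)%:R `^ p) _.
    rewrite [X in X <= _]big_mkcond [X in _ <= X]big_mkcond; apply: ler_sum => v _.
    case: (leP (eps * _)) => /= [_|/ltW->] //.
    by case: ifP; rewrite ?powR_ge0.
  apply: le_trans (sum_small_deg alpha0 alpha1 p_gt C0 exC freeG en0) _.
  rewrite -/q -/C1 -/A powRM ?(ltW eps0) // -mulrA [_ `^ q * _]mulrCA.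
  have -> : #|G|%:R `^ q * #|G|%:R `^ (p - q) = #|G|%:R `^ p :> R.
    by rewrite -powRD ?(gt_eqF nR0) ?implybT // addrC subrK.
  rewrite mulrA ler_wpM2r ?powR_ge0 //.
  apply: le_trans (_ : (A + 1) * (eta / (A + 1)) <= _); last first.
    by rewrite mulrC divfK // gt_eqF.
  by apply: ler_pM => //; [exact: powR_ge0|rewrite lerDl].
rewrite -(ler_nat R); apply: le_trans (ltW ltK).
apply: le_trans (card_deg_ge alpha0 alpha1 C0 exC freeG en0) _.
rewrite -/q -/C1; suff -> : C1 * #|G|%:R / (eps * #|G|%:R) = C1 / eps by [].
by field; rewrite !gt_eqF.
Qed.

(** Take [eta] = 1: the small degrees contribute at most n^p in total, and each of the at most [K]
    other vertices at most n^p. *)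
Lemma e_p_le_few_large (R : realType) (F : seq sgraph) (p : R) :
  1 < p -> few_large_degrees F p ->
  exists2 A : R, 0 <= A &
    forall G : sgraph, family_free F G -> e_p p G <= A * #|G|%:R `^ p.
Proof.
move=> p1 /(_ 1 ltr01)[eps [K few]]; exists (1 + K%:R); first by rewrite addr_ge0.
move=> G /few[small large].
rewrite /e_p (bigID (fun v => eps * #|G|%:R <= (deg v)%:R)) /= addrC mulrDl.
apply: lerD => //; set X := [set _ | _] in large.
apply: le_trans (_ : #|X|%:R * #|G|%:R `^ p <= _); last first.
  by rewrite ler_wpM2r ?powR_ge0 // ler_nat.
rewrite (eq_bigl (fun v => v \in X)) => [|v]; last by rewrite inE.
rewrite mulr_natl -[leRHS]sumr_const; apply: ler_sum => v _.
by apply: le_powR => //; [lra|rewrite ler_nat max_card].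
Qed.

(** For c < 1 put y = (1-c)^(1/p) < 1; the claim reduces to y n <= n - 1, that is n >= 1 / (1-y).
    For c >= 1 the left side is not positive. *)
Lemma near_one_powR (R : realType) (p c : R) : 0 < p -> 0 < c ->
  exists n0 : nat, forall n : nat, (n0 <= n)%N ->
    (1 - c) * n%:R `^ p <= (n%:R - 1) `^ p.
Proof.
move=> p0 c0; have [c1|c1] := leP 1 c.
  exists 0%N => n _; apply: le_trans (_ : 0 <= _); last exact: powR_ge0.
  by apply: mulr_le0_ge0; [lra|exact: powR_ge0].
pose y := (1 - c) `^ p^-1.
have yp : y `^ p = 1 - c by rewrite -powRrM mulVf ?gt_eqF // powRr1 //; lra.
have y0 : 0 <= y by exact: powR_ge0.
have y1 : y < 1.
  by have := @lt_powR R (1 - c) 1 p^-1; rewrite powR1; apply; rewrite ?invr_gt0 //; lra.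
have d0 : 0 < 1 - y by lra.
exists (Num.bound (1 - y)^-1) => n len.
have nR0 : 0 <= n%:R :> R by [].
have : (1 - y)^-1 <= n%:R.
  apply: le_trans (ltW (archi_boundP _)) _; first by rewrite invr_ge0 ltW.
  by rewrite ler_nat.
rewrite -(ler_pM2l d0) mulfV ?gt_eqF // => le_n.
by rewrite -yp -powRM //; apply: le_powR; [exact: ltW|exact: mulr_ge0|lra].
Qed.

Lemma powR_mulB1 (R : realType) (x p : R) : 1 < p -> 0 <= x ->
  x `^ p = x * x `^ (p - 1).
Proof. by move=> p1 x0; rewrite mulr_powRB1 //; lra. Qed.

(** Write d^p as d times d^(p-1): a vertex of degree below (1-gamma) n earns at most [theta] < 1
    times n^(p-1) per unit of degree. The degree total of the large vertices is about s n at most,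
    so reaching s (n-1)^p forces most of it onto vertices of nearly full degree. *)
Lemma stability (R : realType) (F : seq sgraph) (p gamma : R) (s l h : nat) :
  1 < p -> 0 < gamma -> gamma < 1 -> (0 < s)%N -> (l <= h)%N ->
  few_large_degrees F p -> sparse_outside F s l h ->
  exists n0 : nat, forall G : sgraph, (n0 <= #|G|)%N -> family_free F G ->
    s%:R * (#|G|%:R - 1) `^ p <= e_p p G ->
    exists2 S : {set G}, #|S| = s &
      forall v, v \in S -> (1 - gamma) * #|G|%:R <= (deg v)%:R.
Proof.
move=> p1 gamma0 gamma1 s0 le_lh few sparse.
pose theta := (1 - gamma) `^ (p - 1).
have theta0 : 0 <= theta by exact: powR_ge0.
have theta1 : theta < 1.
  by have := @lt_powR R (1 - gamma) 1 (p - 1); rewrite powR1; apply; lra.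
pose eta := (1 - theta) / 6.
have eta0 : 0 < eta by rewrite /eta; lra.
have sR0 : 0 < s%:R :> R by rewrite ltr0n.
have [eps [K large]] := few eta eta0.
have p0 : 0 < p by lra.
have [n1 near1] := near_one_powR p0 (divr_gt0 eta0 sR0).
(* Error term of [sum_deg_le_sparse] for a set of at most [K] vertices. *)
pose M := (K * (2 ^ K * h))%N.
exists (maxn n1 (Num.bound (M%:R / eta)).+1) => G; rewrite geq_max.
set n := #|G| => /andP[/near1 near_n leM] freeG e_p_ge.
have nR0 : 0 < n%:R :> R by rewrite ltr0n (leq_trans _ leM).
have MN : M%:R <= eta * n%:R.
  rewrite mulrC -ler_pdivrMr //; apply: le_trans (ltW (archi_boundP _)) _.
    by rewrite divr_ge0 // ltW.
  by rewrite ler_nat ltnW.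
have [small cardX] := large G freeG.
set X := [set v : G | _] in cardX.
pose Big := [set v in X | (1 - gamma) * n%:R <= (deg v)%:R].
pose Mid := X :\: Big.
pose x : R := \sum_(v in Big) (deg v)%:R.
pose y : R := \sum_(v in Mid) (deg v)%:R.
have sBX : Big \subset X by apply/subsetP => v; rewrite inE => /andP[].
have XBM : X :&: Big = Big by apply/setIidPr.
have split_X (f : G -> R) :
    \sum_(v in X) f v = \sum_(v in Big) f v + \sum_(v in Mid) f v.
  by rewrite (big_setID Big) /= XBM.
have le_deg (v : G) : (deg v)%:R <= n%:R :> R by rewrite ler_nat max_card.
have xy : x + y <= s%:R * n%:R + eta * n%:R.
  rewrite /x /y -split_X; apply: le_trans (_ : _ <= s%:R * n%:R + M%:R) _; last first.
    by rewrite lerD2l.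
  rewrite -natr_sum -natrM -natrD ler_nat.
  apply: leq_trans (sum_deg_le_sparse sparse le_lh _ freeG) _.
  by rewrite leq_add2l /M leq_mul // leq_mul // leq_pexp2l.
pose T := n%:R `^ (p - 1).
have T0 : 0 < T by exact: powR_gt0.
have nT : n%:R `^ p = n%:R * T by exact/powR_mulB1/ltW.
have e_p_le : e_p p G <= T * x + theta * T * y + eta * n%:R `^ p.
  rewrite /e_p (bigID (mem X)) /=; apply: lerD; last first.
    rewrite (eq_bigl (fun v : G => ~~ (eps * n%:R <= (deg v)%:R))) // => v.
    by rewrite inE.
  rewrite split_X; apply: lerD; rewrite mulr_sumr; apply: ler_sum => v.
    move=> _; rewrite powR_mulB1 // mulrC ler_wpM2r //; apply: le_powR => //; lra.
  rewrite inE => /andP[vB vX]; rewrite powR_mulB1 // mulrC ler_wpM2r //.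
  rewrite /theta /T -powRM //; last lra.
  apply: le_powR => //; first lra.
  by move: vB; rewrite inE vX -ltNge => /ltW.
have e_p_ge' : s%:R * n%:R `^ p - eta * n%:R `^ p <= e_p p G.
  apply: le_trans e_p_ge.
  apply: le_trans (ler_wpM2l (ltW sR0) near_n).
  rewrite le_eqVlt; apply/orP; left; apply/eqP; field; exact: lt0r_neq0.
(* After division by [T], one [eta] is lost in replacing (n-1)^p by n^p and one to the small
   degrees. *)
have key : s%:R * n%:R - 2 * eta * n%:R <= x + theta * y.
  by rewrite -(ler_pM2l T0); rewrite nT in e_p_ge' e_p_le; nra.
(* Comparing [key] with [xy] gives (1 - theta) y <= 3 eta n, and 3 eta = (1 - theta) / 2 by the
   choice of [eta]. *)
have y_le : y <= n%:R / 2.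
  have : (1 - theta) * y <= (1 - theta) * (n%:R / 2) by rewrite /eta in key xy; nra.
  by rewrite ler_pM2l // subr_gt0.
have y0 : 0 <= y by apply: sumr_ge0.
have x_le : x <= #|Big|%:R * n%:R.
  by rewrite mulr_natl -[leRHS]sumr_const; apply: ler_sum.
(* Now x >= (s - 2 eta - 1/2) n > (s - 1) n, while each vertex of [Big] adds at most n to x. *)
have s_le : (s <= #|Big|)%N.
  rewrite -ltnS -(ltr_nat R) -(ltr_pM2r nR0) -natr1.
  have : theta * y <= y by rewrite ler_piMl // ltW.
  by rewrite /eta in key; nra.
have [S sS cardS] := exists_subset s_le; exists S => // v /(subsetP sS).
by rewrite inE => /andP[].
Qed.

(** * From nearly full to full degree *)

(** The excess is bounded linearly in [x], so that it can be summed over vertices by counting edges.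
    For x >= 1 it follows from a + x <= x (a + 1). *)
Lemma powR_addn_le (R : realType) (p a : R) (x t : nat) :
  1 < p -> 1 <= a -> (x <= t)%N ->
  (a + x%:R) `^ p <= a `^ p + x%:R * ((a + 1) * (a + t%:R) `^ (p - 1)).
Proof.
move=> p1 a1 xt; have [->|x_gt0] := posnP x; first by rewrite addr0 mul0r addr0.
have x1 : 1 <= x%:R :> R by rewrite ler1n.
apply: le_trans (_ : _ <= x%:R * ((a + 1) * (a + t%:R) `^ (p - 1))) _; last first.
  by rewrite lerDr powR_ge0.
rewrite powR_mulB1 //; last lra.
rewrite mulrA; apply: ler_pM; rewrite ?powR_ge0 //; [lra|nra|].
by apply: le_powR; rewrite ?lerD2l ?ler_nat //; lra.
Qed.

Lemma powR_add_le (R : realType) (p x y : R) : 0 < p -> 0 <= x -> 0 <= y ->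
  (x + y) `^ p <= 2 `^ p * (x `^ p + y `^ p).
Proof.
move=> p0; wlog xy : x y / x <= y => [le_xy x0 y0|x0 y0].
  have [/le_xy|/ltW/le_xy] := leP x y; first exact.
  by move=> le_yx; rewrite addrC [x `^ p + _]addrC; apply: le_yx.
apply: le_trans (_ : (2 * y) `^ p <= _); first by apply: le_powR; lra.
by rewrite powRM // ler_wpM2l ?powR_ge0 // lerDr powR_ge0.
Qed.

(* [W] is the set of common neighbours of [S] and [T] the rest. A vertex outside
   [S] has at most [s + (l - 1)] neighbours in [S :|: W]; the excess on [W]
   is controlled by the at most [#|T| (l - 1)] edges between [W] and [T], the
   excess on [T] by the bound on [e_p] applied to the graph induced on [T]. *)
Lemma e_p_outside_le (R : realType) (F : seq sgraph) (p A a : R) (s l : nat)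
    (G : sgraph) (S : {set G}) :
  a = (s + (l - 1))%:R -> 1 < p -> (0 < s)%N -> 0 <= A ->
  (forall G : sgraph, family_free F G -> e_p p G <= A * #|G|%:R `^ p) ->
  family_free F G -> #|S| = s ->
  (forall u, u \notin S -> (#|nbrs u :&: common_nbrs S| < l)%N) ->
  \sum_(u in ~: S) (deg u)%:R `^ p <=
    (#|G|%:R - s%:R) * a `^ p +
    (a * (a + 1) `^ p + 2 `^ p * (a `^ p + A)) *
    #|~: (S :|: common_nbrs S)|%:R `^ p.
Proof.
move=> aE p1 s0 A0 boundA freeG cardS leW.
set W := common_nbrs S in leW *; set T := ~: (S :|: W); set t := #|T|.
have a1 : 1 <= a by rewrite aE ler1n addn_gt0 s0.
pose x (u : G) := #|nbrs u :&: T|.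
have le_deg u : u \notin S -> (deg u)%:R <= a + (x u)%:R :> R.
  move=> uS; rewrite aE -natrD ler_nat degE.
  have -> : nbrs u = (nbrs u :&: S) :|: (nbrs u :&: W) :|: (nbrs u :&: T).
    by rewrite -!setIUr setUCr setIT.
  apply: leq_trans (leq_card_setU _ _) _; rewrite leq_add2r.
  apply: leq_trans (leq_card_setU _ _) _; apply: leq_add.
    by rewrite -cardS subset_leq_card // subsetIr.
  by rewrite leq_subRL; move: (leW u uS); clear; lia.
have SW : [disjoint S & W].
  rewrite disjoint_subset; apply/subsetP => v vS; rewrite inE.
  by apply/negP => /(common_nbrs_notin vS); rewrite eqxx.
have SCE : ~: S = W :|: T.
  apply/setP => v; rewrite in_setC in_setU in_setC in_setU negb_or.
  have [vW|_] := boolP (v \in W); last by rewrite andbT.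
  by rewrite (disjointFl SW vW).
have WT : [disjoint W & T].
  rewrite disjoint_subset; apply/subsetP => v vW.
  by rewrite inE /= /T in_setC in_setU vW orbT.
have cardW : #|W|%:R <= #|G|%:R - s%:R :> R.
  rewrite lerBrDr -natrD ler_nat -cardS addnC.
  by rewrite -(cardsC S) leq_add2l subset_leq_card // SCE subsetUl.
have x_le_t u : (x u <= t)%N by rewrite subset_leq_card // subsetIr.
have t0 : 0 <= t%:R :> R by [].
have sum_W : \sum_(u in W) (deg u)%:R `^ p <=
    (#|G|%:R - s%:R) * a `^ p + a * (a + 1) `^ p * t%:R `^ p.
  have WS u : u \in W -> u \notin S by move=> uW; rewrite (disjointFl SW uW).
  apply: le_trans (_ : _ <= \sum_(u in W) (a `^ p +
      (x u)%:R * ((a + 1) * (a + t%:R) `^ (p - 1)))) _.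
    apply: ler_sum => u uW; apply: le_trans (powR_addn_le p1 a1 (x_le_t u)).
    by apply: le_powR => //; [lra|exact/le_deg/WS].
  rewrite big_split /= sumr_const -[_ *+ #|W|]mulr_natl -mulr_suml -natr_sum.
  apply: lerD; first by rewrite ler_wpM2r ?powR_ge0.
  (* Double counting: each vertex of [T] has fewer than [l] neighbours in [W], hence at most [a]. *)
  have le_x : (\sum_(u in W) x u)%:R <= t%:R * a.
    rewrite aE -natrM ler_nat /x sum_nbrsI -sum_nat_const; apply: leq_sum => u.
    by rewrite in_setC in_setU negb_or => /andP[/leW]; clear; lia.
  have [t_eq0|t_gt0] := posnP t.
    have -> : (\sum_(u in W) x u)%:R = 0 :> R.
      by apply/eqP; rewrite eq_le ler0n andbT (le_trans le_x) // t_eq0 mul0r.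
    by rewrite mul0r !mulr_ge0 ?powR_ge0 //; lra.
  have t1 : 1 <= t%:R :> R by rewrite ler1n.
  have ap0 : 0 <= a + 1 by lra.
  have le_at : (a + t%:R) `^ (p - 1) <= (a + 1) `^ (p - 1) * t%:R `^ (p - 1).
    by rewrite -powRM //; apply: le_powR; [lra|lra|nra].
  rewrite [(a + 1) `^ p]powR_mulB1 // [t%:R `^ p]powR_mulB1 //.
  apply: le_trans (ler_pM _ _ le_x (ler_wpM2l ap0 le_at)) _ => //.
    by rewrite mulr_ge0 ?powR_ge0.
  by rewrite le_eqVlt; apply/orP; left; apply/eqP; ring.
have sum_T : \sum_(u in T) (deg u)%:R `^ p <=
    2 `^ p * (a `^ p + A) * t%:R `^ p.
  have TS u : u \in T -> u \notin S by rewrite in_setC in_setU negb_or => /andP[].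
  have freeT : family_free F (induced T).
    exact: family_free_sub (subgraph_induced _) freeG.
  have sum_x : \sum_(u in T) (x u)%:R `^ p <= A * t%:R `^ p.
    have := boundA _ freeT; rewrite card_induced; apply: le_trans.
    rewrite /e_p big_sub /= le_eqVlt; apply/orP; left; apply/eqP.
    by apply: eq_bigr => u _; rewrite deg_induced.
  (* Absorbs the term t a^p into a multiple of t^p. *)
  have t_le : t%:R <= t%:R `^ p :> R.
    have [->|t_gt0] := posnP t; first by rewrite powR_ge0.
    by apply: le1r_powR; [rewrite ler1n|exact: ltW].
  apply: le_trans (_ : _ <= \sum_(u in T) (2 `^ p * (a `^ p + (x u)%:R `^ p))) _.
    apply: ler_sum => u uT; apply: le_trans (powR_add_le _ _ _) => //; [|lra|lra].
    by apply: le_powR => //; [lra|exact/le_deg/TS].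
  rewrite -mulr_sumr big_split /= sumr_const -[_ *+ #|T|]mulr_natl -mulrA.
  rewrite ler_wpM2l ?powR_ge0 // mulrDl lerD // mulrC ler_wpM2l ?powR_ge0 //.
rewrite (eq_bigl [predU W & T]) => [|u]; last by rewrite SCE !inE.
rewrite bigU // [(_ + 2 `^ p * _) * _]mulrDl addrA; exact: lerD.
Qed.

Lemma large_powR (R : realType) (r c : R) : 0 < r ->
  exists n0 : nat, forall n : nat, (n0 <= n)%N -> c < (n%:R - 1) `^ r.
Proof.
move=> r0; have [c0|c_gt0] := ltP c 0.
  by exists 0%N => n _; apply: lt_le_trans c0 (powR_ge0 _ _).
exists (Num.bound (c `^ r^-1)).+1 => n len.
have -> : c = (c `^ r^-1) `^ r by rewrite -powRrM mulVf ?gt_eqF // powRr1.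
apply: lt_powR => //; first exact: powR_ge0.
have := archi_boundP (powR_ge0 c r^-1) => /lt_le_trans; apply.
by rewrite lerBrDr natr1 ler_nat.
Qed.

(** The edges missing at [S], D in number with multiplicity, cost D (n-1)^(p-1). The gain outside is
    at most B D^p, and [gamma] is so small that this is at most half the cost. The lower bound on
    [e_p] counts n - s - 1 outer vertices, one fewer than there are, to allow for the exceptional
    vertex of a near regular graph. *)
Lemma bootstrap (R : realType) (F : seq sgraph) (p A : R) (s l h : nat) :
  1 < p -> (0 < s)%N -> 0 <= A ->
  (forall G : sgraph, family_free F G -> e_p p G <= A * #|G|%:R `^ p) ->
  sparse_outside F s l h ->
  exists gamma : R, [/\ 0 < gamma, gamma < 1 &
  exists n0 : nat, forall (G : sgraph) (S : {set G}),
    (n0 <= #|G|)%N -> family_free F G -> #|S| = s ->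
    (forall v, v \in S -> (1 - gamma) * #|G|%:R <= (deg v)%:R) ->
    s%:R * (#|G|%:R - 1) `^ p
      + (#|G|%:R - s%:R - 1) * (s + (l - 1))%:R `^ p <= e_p p G ->
    (forall v, v \in S -> deg v = #|G| - 1)%N /\
    (forall u, u \notin S -> #|nbrs u :&: ~: S| < l)%N].
Proof.
move=> p1 s0 A0 boundA sparse.
set a : R := (s + (l - 1))%:R.
pose B := a * (a + 1) `^ p + 2 `^ p * (a `^ p + A).
have a1 : 1 <= a by rewrite ler1n addn_gt0 s0.
have B0 : 0 < B.
  rewrite /B ltr_pwDl ?mulr_ge0 ?addr_ge0 ?powR_ge0 //.
  by rewrite mulr_gt0 ?powR_gt0 //; lra.
have e0 : 0 < p - 1 by lra.
have B2 : 0 < (2 * B)^-1 by rewrite invr_gt0 mulr_gt0.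
have [r [r0 r1 le_r]] := exists_small_powR B2 e0.
have sR1 : 1 <= s%:R :> R by rewrite ler1n.
pose gamma := r / (2 * s%:R).
have gs : gamma * s%:R = r / 2 by rewrite /gamma; field; lra.
have gamma0 : 0 < gamma by rewrite divr_gt0 //; lra.
exists gamma; split => //; first by nra.
have [n1 large] := large_powR (2 * a `^ p) e0.
(* [n1] makes (n-1)^(p-1) exceed 2 a^p; the other bound gives [S] more than [h] common neighbours,
   so that one may be removed in [sparse_outside]. *)
exists (maxn n1 (2 * (s + h + 1))) => G S; rewrite geq_max; set n := #|G|.
case/andP=> /large n_large le_n freeG cardS degS e_p_ge.
have n2N : (2 <= n)%N by move: s0 le_n; clear; lia.
have n2 : 2 <= n%:R :> R by rewrite ler_nat.
have deg_le (v : G) : (deg v <= n - 1)%N.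
  rewrite degE /n -cardsT [#|[set: G]|](cardsD1 v) in_setT add1n subn1 /=.
  apply/subset_leq_card/subsetP => w; rewrite !inE andbT.
  by apply: contraTneq => ->; rewrite adj_irr.
pose D := (\sum_(v in S) (n - 1 - deg v))%N.
have cardT : (#|~: (S :|: common_nbrs S)| <= D)%N by exact: card_common_nbrs_compl.
set T := ~: _ in cardT.
have natn1 : (n - 1)%:R = n%:R - 1 :> R by rewrite natrB // ltnW.
have D_eq : D%:R = s%:R * (n%:R - 1) - \sum_(v in S) (deg v)%:R :> R.
  rewrite /D natr_sum mulr_natl -cardS -sumr_const -sumrB.
  by apply: eq_bigr => v _; rewrite natrB // natn1.
have D_le_gamma : D%:R <= s%:R * (gamma * n%:R).
  rewrite /D natr_sum mulr_natl -cardS -sumr_const; apply: ler_sum => v vS.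
  by rewrite natrB // natn1; have := degS v vS; lra.
rewrite mulrA [s%:R * _]mulrC gs in D_le_gamma.
have D_le : D%:R <= r * (n%:R - 1).
  by move: D_le_gamma r0 r1 n2; clear; nra.
have cardW : (h < #|common_nbrs S|)%N.
  have : (n <= #|S| + #|common_nbrs S| + #|T|)%N.
    by rewrite /n -(cardsC (S :|: common_nbrs S)) leq_add2r leq_card_setU.
  have : (2 * #|T| <= n)%N.
    rewrite -(ler_nat R) natrM.
    have : #|T|%:R <= D%:R :> R by rewrite ler_nat.
    by move: D_le_gamma r0 r1 n2; clear; nra.
  by move: le_n; rewrite cardS; clear; lia.
have leW u : u \notin S -> (#|nbrs u :&: common_nbrs S| < l)%N.
  move=> uS; apply: (sparse _ freeG _ _ cardS uS).
  by move: cardW; rewrite (cardsD1 u); case: (_ \in _); clear; lia.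
have sum_out := e_p_outside_le (erefl a) p1 s0 A0 boundA freeG cardS leW.
rewrite -/B -/n -/T in sum_out.
pose P := (n%:R - 1) `^ (p - 1).
have P0 : 0 < P by apply: powR_gt0; lra.
have nP : (n%:R - 1) `^ p = (n%:R - 1) * P by apply: powR_mulB1 => //; lra.
have sum_in : \sum_(v in S) (deg v)%:R `^ p <= P * (s%:R * (n%:R - 1) - D%:R).
  rewrite D_eq subKr mulr_sumr; apply: ler_sum => v vS.
  rewrite powR_mulB1 // mulrC ler_wpM2r //; apply: le_powR => //; first lra.
  by rewrite -natn1 ler_nat.
(* B D^p is B D times D^(p-1), where D <= r (n-1) and r^(p-1) <= 1 / (2B). *)
have T_le : B * #|T|%:R `^ p <= D%:R * P / 2.
  apply: le_trans (_ : B * D%:R `^ p <= _).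
    by rewrite ler_wpM2l ?(ltW B0) //; apply: le_powR; rewrite ?ler_nat //; lra.
  rewrite powR_mulB1 //.
  have : D%:R `^ (p - 1) <= (2 * B)^-1 * P.
    apply: le_trans (_ : (r * (n%:R - 1)) `^ (p - 1) <= _).
      by apply: le_powR => //; lra.
    by rewrite powRM ?ler_wpM2r ?powR_ge0 //; lra.
  have BD : 0 <= B * D%:R by rewrite mulr_ge0 // ltW.
  move/(ler_wpM2l BD); rewrite mulrA => /le_trans; apply.
  by rewrite le_eqVlt; apply/orP; left; apply/eqP; field; lra.
have e_p_eq : e_p p G =
    \sum_(v in S) (deg v)%:R `^ p + \sum_(v in ~: S) (deg v)%:R `^ p.
  rewrite /e_p (bigID (mem S)) /=; congr (_ + _).
  by apply: eq_bigl => v; rewrite inE.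
(* The outer sums cancel up to a single a^p, leaving D P / 2 <= a^p, which contradicts P > 2 a^p as
   soon as D >= 1. *)
have D0 : D = 0%N.
  apply/eqP; rewrite eqn0Ngt; apply/negP => D_gt0.
  have D1 : 1 <= D%:R :> R by rewrite ler1n.
  have : D%:R * P / 2 <= a `^ p.
    by rewrite e_p_eq -/a nP in e_p_ge; nra.
  have : P <= D%:R * P by rewrite ler_peMl // ltW.
  by move: n_large; rewrite -/P; lra.
have T0 : T = set0 by apply/eqP; rewrite -cards_eq0; move: cardT; rewrite D0 leqn0.
split=> [v vS|u uS].
  move: D0; rewrite /D (bigD1 v) //= => /eqP; rewrite addn_eq0 => /andP[/eqP vD _].
  by move: (deg_le v) vD; clear; lia.
apply: leq_ltn_trans (leW u uS); apply/subset_leq_card/setIS/subsetP => w.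
rewrite in_setC => wS; have : w \notin T by rewrite T0 inE.
by rewrite in_setC negbK in_setU (negbTE wS).
Qed.

(** * Comparison with the extremal family *)

Lemma isomorphic_e_p (R : realType) (p : R) (G1 G2 : sgraph) :
  isomorphic G1 G2 -> e_p p G1 = e_p p G2.
Proof.
case=> f fbij fadj; rewrite /e_p [RHS](reindex f) /=; last exact: onW_bij.
by apply: eq_bigr => v _; rewrite isomorphic_deg.
Qed.

Lemma e_p_le_ex_p (R : realType) (p : R) (F : seq sgraph) (n : nat) (G : sgraph) :
  family_free F G -> #|G| = n -> e_p p G <= ex_p p n F.
Proof.
move=> freeG cardG; have [E isoE] := graph_of_edges_surj cardG.
rewrite (isomorphic_e_p p isoE).
apply: (le_bigmax_cond _ (fun E : {set {set 'I_n}} => e_p p (graph_of_edges E))).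
by apply: family_free_sub freeG; apply/isomorphic_subgraph/isomorphic_sym.
Qed.

Section JoinComplete.
Variables (s : nat) (L : sgraph).
Local Open Scope nat_scope.

Lemma deg_join_inl (i : 'I_s) :
  deg (inl i : join (complete s) L) = s + #|L| - 1.
Proof.
have -> : s + #|L| = #|join (complete s) L| by rewrite card_sum card_ord.
rewrite degE -cardsT [#|[set: _]|](cardsD1 (inl i)) in_setT add1n subn1 /=.
apply: eq_card => -[j|w]; rewrite !inE /= ?andbT //.
by rewrite /complete_adj [i == j]eq_sym.
Qed.

Lemma deg_join_inr (v : L) : deg (inr v : join (complete s) L) = s + deg v.
Proof.
rewrite !degE -!sum1_card big_sumType /=; congr (_ + _).
  rewrite (eq_bigl predT) => [|i]; last by rewrite inE.
  by rewrite sum1_card card_ord.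
by apply: eq_bigl => w; rewrite !inE.
Qed.

Lemma e_p_join (R : realType) (p : R) :
  e_p p (join (complete s) L) =
    (s%:R * (s + #|L| - 1)%:R `^ p + \sum_(v : L) (s + deg v)%:R `^ p)%R.
Proof.
rewrite /e_p big_sumType /=; congr (_ + _)%R.
  under eq_bigr do rewrite deg_join_inl.
  by rewrite sumr_const card_ord mulr_natl.
by apply: eq_bigr => v _; rewrite deg_join_inr.
Qed.
End JoinComplete.

(** A vertex of degree [#|G| - 1] is adjacent to every other vertex, so [S] is a clique completely
    joined to its complement. *)
Lemma isomorphic_join_complete (G : sgraph) (S : {set G}) :
  (forall v, v \in S -> deg v = #|G| - 1)%N ->
  isomorphic G (join (complete #|S|) (induced (~: S))).
Proof.
move=> full; set L := induced _; apply: isomorphic_sym.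
have adjS v w : v \in S -> v != w -> adj v w.
  move=> vS vw; have sub : nbrs v \subset [set~ v].
    by apply/subsetP => x; rewrite !inE; apply: contraTneq => ->; rewrite adj_irr.
  have : nbrs v == [set~ v].
    by rewrite eqEcard sub cardsC1 -subn1 -(full v) ?leqnn.
  by move/eqP/setP/(_ w); rewrite !inE eq_sym vw.
pose g (x : join (complete #|S|) L) : G :=
  match x with inl i => enum_val i | inr v => val v end.
have valS (v : L) : val v \notin S by rewrite -in_setC (valP v).
have g_inj : injective g.
  move=> [i|v] [j|w] /= => [/enum_val_inj->|e|e|/val_inj->] //.
    by have := valS w; rewrite /= -e enum_valP.
  by have := valS v; rewrite /= e enum_valP.
exists g.
  apply: inj_card_bij g_inj _.
  by rewrite card_sum card_ord card_induced cardsC.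
move=> [i|v] [j|w] //=.
- rewrite /complete_adj; case: (eqVneq i j) => [->|ij]; first by rewrite adj_irr.
  by apply: adjS; rewrite ?enum_valP // (inj_eq enum_val_inj).
- apply: adjS; rewrite ?enum_valP //.
  by apply: contraTneq (enum_valP i) => ->; exact: valS.
- rewrite adj_sym; apply: adjS; rewrite ?enum_valP //.
  by apply: contraTneq (enum_valP j) => ->; exact: valS.
Qed.

(** At most one vertex has degree other than [k], and its term is dropped as nonnegative. *)
Lemma sum_near_regular_ge (R : realType) (f : nat -> R) (k : nat) (L : sgraph) :
  (forall d, 0 <= f d) -> near_regular k L ->
  (#|L|%:R - 1) * f k <= \sum_(v : L) f (deg v).
Proof.
move=> f0; rewrite /near_regular; case: ifP => _.
  move=> reg; under eq_bigr do rewrite reg.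
  rewrite sumr_const -[leRHS]mulr_natl ler_wpM2r //; lra.
case=> v [_ reg]; rewrite (bigD1 v) //=; apply: ler_wpDl => //.
rewrite (eq_bigr (fun=> f k)) => [|w /reg->//].
rewrite sumr_const -[leRHS]mulr_natl ler_wpM2r //.
by rewrite lerBlDr natr1 ler_nat cardC1 leqSpred.
Qed.

(* When [k * #|L|] is odd, parity of the degree sum forces a vertex of degree
   less than [k], so near regularity is optimal. *)
Lemma near_regular_of_sum (R : realType) (f : nat -> R) (k : nat) (L L0 : sgraph) :
  {homo f : x y / (x < y)%N >-> x < y} -> #|L| = #|L0| ->
  near_regular k L0 -> (forall v : L, (deg v <= k)%N) ->
  \sum_(v : L0) f (deg v) <= \sum_(v : L) f (deg v) -> near_regular k L.
Proof.
move=> f_lt cardL reg0 deg_le le_sum.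
have f_le x y : (x <= y)%N -> f x <= f y.
  by rewrite leq_eqVlt => /orP[/eqP->//|/f_lt/ltW].
(* The loss at [v] against full degree [k]; the losses are nonnegative, and their total cannot
   exceed that of [L0]. *)
pose g (v : L) := f k - f (deg v).
have g0 v : 0 <= g v by rewrite subr_ge0 f_le.
have gk v : g v <= 0 -> deg v = k.
  rewrite subr_le0 => le_f; apply/eqP; rewrite eqn_leq deg_le leqNgt.
  by apply/negP => /f_lt; rewrite ltNge le_f.
have sum_g : \sum_v g v = \sum_(v : L0) f k - \sum_(v : L) f (deg v).
  by rewrite /g sumrB !sumr_const cardL.
move: reg0; rewrite /near_regular cardL; case: ifP => [_ reg v|odd0 [v0 [degv0 reg]]].
  apply: gk; apply: le_trans (_ : \sum_v g v <= 0).
    by rewrite (bigD1 v) //= lerDl sumr_ge0.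
  rewrite sum_g subr_le0; apply: le_trans le_sum.
  by apply: ler_sum => w _; rewrite reg.
have sum_le : \sum_v g v <= f k - f (k - 1)%N.
  apply: le_trans (_ : \sum_(v : L0) f k - \sum_(v : L0) f (deg v) <= _).
    by rewrite sum_g lerD2l lerN2.
  rewrite -sumrB (bigD1 v0) //= degv0 big1 ?addr0 // => w /reg->.
  by rewrite subrr.
have [v vk] : exists v : L, deg v != k.
  apply/existsP; move: odd0; apply: contraFT => /existsPn allk.
  have -> : (k * #|L0| = \sum_(v : L) deg v)%N.
    rewrite -cardL mulnC -sum_nat_const; apply: eq_bigr => v _.
    by have := allk v; rewrite negbK => /eqP.
  exact: odd_sum_deg.
have lt_vk : (deg v < k)%N by rewrite ltn_neqAle vk deg_le.
have le_v : (deg v <= k - 1)%N by rewrite leq_subRL ?add1n // (leq_ltn_trans _ lt_vk).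
(* This vertex alone uses up the whole loss of [L0], so every other vertex loses nothing and [v]
   itself has degree exactly [k - 1]. *)
have gv : f k - f (k - 1)%N <= g v by rewrite lerD2l lerN2 f_le.
move: sum_le; rewrite (bigD1 v) //= => sum_le.
have rest0 : 0 <= \sum_(w | w != v) g w by apply: sumr_ge0.
exists v; split=> [|w wv].
  apply/eqP; rewrite eqn_leq le_v leqNgt; apply/negP => /f_lt.
  by move: sum_le rest0; rewrite /g; lra.
apply: gk; apply: le_trans (_ : \sum_(w | w != v) g w <= _); last lra.
by rewrite (bigD1 w) //= lerDl sumr_ge0.
Qed.

(** The given member [H] bounds [e_p p G] from below, which feeds [stability] and then [bootstrap].
    So [G] is a join over [s] dominating vertices, and it remains to compare the outer graphs of [G]
    and [H]. *)
Lemma extremal_in_calL (R : realType) (F : seq sgraph) (p : R) (s l h : nat) :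
  1 < p -> (0 < s)%N -> (l <= h)%N ->
  few_large_degrees F p -> sparse_outside F s l h ->
  exists n0 : nat, forall n : nat, (n0 <= n)%N ->
    forall G : sgraph, #|G| = n -> family_free F G ->
      e_p p G = ex_p p n F ->
      (exists H : sgraph, in_calL n s (l - 1) H /\ family_free F H) ->
      in_calL n s (l - 1) G.
Proof.
move=> p1 s0 le_lh few sparse.
have p0 : 0 < p by lra.
have [A A0 boundA] := e_p_le_few_large p1 few.
have [gamma [gamma0 gamma1 [n1 boot]]] := bootstrap p1 s0 A0 boundA sparse.
have [n2 stab] := stability p1 gamma0 gamma1 s0 le_lh few sparse.
exists (maxn n1 n2) => n; rewrite geq_max => /andP[le1 le2] G cardG freeG e_pG.
case=> H [[L0 [cardL0 reg0 isoH]] freeH]; rewrite -cardG in le1 le2.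
(* What a vertex of degree [d] in the outer graph contributes to [e_p] of the join. *)
pose f d : R := (s + d)%:R `^ p.
have f0 d : 0 <= f d by exact: powR_ge0.
have f_lt : {homo f : x y / (x < y)%N >-> x < y}.
  by move=> x y xy; apply: lt_powR => //; rewrite ltr_nat ltn_add2l.
have e_pH : e_p p H = s%:R * (#|G|%:R - 1) `^ p + \sum_(v : L0) f (deg v).
  rewrite (isomorphic_e_p p isoH) e_p_join cardL0 cardG natrB //.
  by rewrite -cardL0 addn_gt0 s0.
have e_p_ge : e_p p H <= e_p p G.
  rewrite e_pG; apply: e_p_le_ex_p => //; case: isoH => f' /bij_eq_card-> _.
  by rewrite card_sum card_ord.
have sum_ge := sum_near_regular_ge f0 reg0.
have cardL0R : #|L0|%:R = #|G|%:R - s%:R :> R.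
  by rewrite cardG -cardL0 natrD addrAC subrr add0r.
have [|S cardS degS] := stab G le2 freeG.
  by apply: le_trans e_p_ge; rewrite e_pH lerDl sumr_ge0.
have [|fullS lowS] := boot G S le1 freeG cardS degS.
  by apply: le_trans e_p_ge; rewrite e_pH lerD2l -cardL0R.
have isoG := isomorphic_join_complete fullS; rewrite cardS in isoG.
have cardL : #|induced (~: S)| = #|L0|.
  apply/eqP; rewrite -(eqn_add2l s) cardL0 card_induced -cardG -cardS.
  by rewrite cardsC.
exists (induced (~: S)); split=> //; first by rewrite cardL.
apply: (near_regular_of_sum f_lt cardL reg0) => [v|].
  have vS : val v \notin S by rewrite -in_setC (valP v).
  by rewrite deg_induced; move: (lowS _ vS); clear; lia.
move: e_p_ge; rewrite e_pH (isomorphic_e_p p isoG) e_p_join cardL cardL0 -cardG.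
by rewrite natrB ?lerD2l // cardG -cardL0 addn_gt0 s0.
Qed.

(** * From the asymptotic edge bound to the theorem *)

Lemma ex0 (F : seq sgraph) : ex 0 F = 0%N.
Proof.
apply/eqP; rewrite -leqn0; apply/bigmax_leqP => E _.
rewrite leqn0 cards_eq0; apply/eqP/setP => e; rewrite !inE.
by apply/existsP => -[[]].
Qed.

From mathcomp Require Import all_classical all_reals all_analysis.

Import numFieldNormedType.Exports.

Local Open Scope classical_set_scope.
Local Open Scope ring_scope.

(** The finitely many orders below the threshold are absorbed by adding the sum of their extremal
    numbers to the constant, since k^(1+alpha) >= 1 for k >= 1. Order 0, where the right side
    vanishes, needs [ex0]. *)
Lemma ex_bound_all (R : realType) (F : seq sgraph) (alpha : R) :
  0 <= alpha ->
  (fun n : nat => (ex n F)%:R : R) =O_\oo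
    (fun n : nat => n%:R `^ (1 + alpha) : R) ->
  exists2 C : R, 0 <= C &
    forall k : nat, (ex k F)%:R <= C * k%:R `^ (1 + alpha).
Proof.
move=> alpha0 /eqO_exP[C0 C0_gt0 [N _ leC0]].
pose M := (\sum_(k < N) ex k F)%N.
exists (C0 + M%:R) => [|k]; first by rewrite addr_ge0 // ltW.
have [->|k_gt0] := posnP k.
  by rewrite ex0 mulr_ge0 ?powR_ge0 // addr_ge0 // ltW.
rewrite mulrDl; have [le_Nk|lt_kN] := leqP N k.
  apply: le_trans (_ : C0 * k%:R `^ (1 + alpha) <= _).
    by have := leC0 k le_Nk; rewrite /= !ger0_norm ?powR_ge0.
  by rewrite lerDl mulr_ge0 ?powR_ge0.
have pow1 : 1 <= k%:R `^ (1 + alpha) :> R.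
  by rewrite -[leLHS](powRr0 k%:R) ler_powR ?ler1n //; lra.
have exM : (ex k F)%:R <= M%:R :> R.
  by rewrite ler_nat /M (bigD1 (Ordinal lt_kN)) //= leq_addr.
apply: le_trans exM _; apply: le_trans (_ : M%:R * k%:R `^ (1 + alpha) <= _).
  by rewrite ler_peMr.
by rewrite lerDr mulr_ge0 ?powR_ge0 // ltW.
Qed.

Theorem corollary1p5 (R : realType) (F : seq sgraph) (alpha p : R)
  (F_degenerate : degenerate F)
  (alpha_ge0 : 0 <= alpha) (alpha_lt1 : alpha < 1)
  (ex_bound : (fun n : nat => (ex n F)%:R : R) =O_\oo
              (fun n : nat => n%:R `^ (1 + alpha) : R))
  (tau_ge2 : (2 <= family_tau F)%N)
  (p_gt : 1 / (1 - alpha) < p) :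
  exists n0 : nat, forall n : nat, (n0 <= n)%N ->
    forall G : sgraph, #|G| = n -> family_free F G ->
      e_p p G = ex_p p n F ->
      (exists H : sgraph,
         in_calL n (family_tau F - 1) (family_ell F - 1) H /\ family_free F H) ->
      in_calL n (family_tau F - 1) (family_ell F - 1) G.
Proof.
rewrite div1r in p_gt.
have p1 : 1 < p by apply: le_lt_trans p_gt; rewrite invf_ge1 ?subr_gt0 // gerBl.
have [C C0 exC] := ex_bound_all alpha_ge0 ex_bound.
have few := few_large_degrees_ex alpha_ge0 alpha_lt1 p_gt C0 exC.
have [h le_lh sparse] := sparse_outside_family F_degenerate tau_ge2.
by apply: (extremal_in_calL p1 _ le_lh few sparse); rewrite subn_gt0.
Qed.
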